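(* For every $n\ge 4$, $g(n,K_4|\langle K_3\rangle)=n$, and $g(n,K_4-e|\langle K_3\rangle)=1$.
   Context: $K_4-e$ is the graph obtained from $K_4$ by deleting one edge. For a graph $F$, $\langle F\rangle$ is the family of all graphs containing $F$ as a subgraph (not necessarily induced). In an edge coloring of $K_n$ (not necessarily proper), for a copy $G'\subseteq K_n$ of a graph $G$ (a not necessarily induced subgraph isomorphic to $G$), a color class of $G'$ is the graph formed by all edges of $G'$ having a given color that occurs in $G'$. For a family $\mathcal{F}$ of graphs with $K_2\notin\mathcal{F}$ and $n\ge|G|$, $g(n,G|\mathcal{F})$ is the largest integer $m$ for which there exists an edge coloring of $K_n$ using exactly $m$ colors such that every copy of $G$ contains a color class which is a member of $\mathcal{F}$; if no such coloring exists, then $g(n,G|\mathcal{F}):=0$. *)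

(* Defs.v *)
From mathcomp Require Import all_boot.

Set Implicit Arguments.
Unset Strict Implicit.
Unset Printing Implicit Defensive.

Record sgraph := SGraph {
  vert :> finType;
  adj : rel vert;
  adj_sym : symmetric adj;
  adj_irr : irreflexive adj }.

Lemma complete_sym n : symmetric (fun x y : 'I_n => x != y).
Proof. by move=> x y; rewrite eq_sym. Qed.

Lemma complete_irr n : irreflexive (fun x y : 'I_n => x != y).
Proof. by move=> x; rewrite eqxx. Qed.

Definition complete (n : nat) : sgraph :=
  SGraph (@complete_sym n) (@complete_irr n).

Section DelEdge.
Variables (G : sgraph) (u v : G).

Definition del_edge_rel : rel G :=
  fun x y => adj x y && ([set x; y] != [set u; v]).

Lemma del_edge_sym : symmetric del_edge_rel.
Proof. by move=> x y; rewrite /del_edge_rel adj_sym setUC. Qed.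

Lemma del_edge_irr : irreflexive del_edge_rel.
Proof. by move=> x; rewrite /del_edge_rel adj_irr. Qed.

Definition del_edge : sgraph := SGraph del_edge_sym del_edge_irr.
End DelEdge.

Definition K4_minus_e : sgraph :=
  @del_edge (complete 4) (ord0 : 'I_4) (ord_max : 'I_4).

Definition contains (F G : sgraph) : bool :=
  [exists f : {ffun F -> G},
     injectiveb f && [forall x, forall y, adj x y ==> adj (f x) (f y)]].

Definition family := pred sgraph.

(* The family written <F> in the literature. *)
Definition supergraphs (F : sgraph) : family := fun G => contains F G.

(* The graph formed by a set of edges: its vertices are the endpoints of these
   edges, so there are no isolated vertices. *)
Section EdgeGraph.
Variables (T : finType) (A : {set {set T}}).

Definition edge_graph_rel : rel {x : T | x \in cover A} :=
  fun x y => (x != y) && ([set val x; val y] \in A).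

Lemma edge_graph_sym : symmetric edge_graph_rel.
Proof. by move=> x y; rewrite /edge_graph_rel eq_sym setUC. Qed.

Lemma edge_graph_irr : irreflexive edge_graph_rel.
Proof. by move=> x; rewrite /edge_graph_rel eqxx. Qed.

Definition edge_graph : sgraph := SGraph edge_graph_sym edge_graph_irr.
End EdgeGraph.

Definition edges (n : nat) : {set {set 'I_n}} :=
  [set e : {set 'I_n} | #|e| == 2].

(* Only the values on [edges n] are ever used. *)
Definition coloring (n m : nat) := {ffun {set 'I_n} -> 'I_m}.

Definition uses_all_colors n m (c : coloring n m) : bool :=
  [forall k, k \in c @: edges n].

(* The edge set of the copy of G in K_n that is the image of the injection f. *)
Definition copy_edges (G : sgraph) n (f : {ffun G -> 'I_n}) : {set {set 'I_n}} :=
  [set [set f p.1; f p.2] | p : G * G & adj p.1 p.2].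

Definition color_class n m (c : coloring n m) (E : {set {set 'I_n}}) (k : 'I_m)
    : sgraph :=
  edge_graph [set e in E | c e == k].

Definition every_copy_has_class n m (c : coloring n m) (G : sgraph)
    (Fam : family) : bool :=
  [forall f : {ffun G -> 'I_n}, injectiveb f ==>
     [exists k, (k \in c @: copy_edges f)
                && Fam (color_class c (copy_edges f) k)]].

Definition admissible (n : nat) (G : sgraph) (Fam : family) (m : nat) : bool :=
  [exists c : coloring n m, uses_all_colors c && every_copy_has_class c G Fam].

(* By [admissible_bound] the range of the maximum loses nothing; the maximum is
   0 when no m is admissible. *)
Definition g (n : nat) (G : sgraph) (Fam : family) : nat :=
  \max_(m < 'C(n, 2).+1 | admissible n G Fam m) m.

Lemma admissible_bound n G Fam m : admissible n G Fam m -> m <= 'C(n, 2).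
Proof.
case/existsP=> c /andP[/forallP allc _].
have -> : 'C(n, 2) = #|edges n|.
  by rewrite -[in LHS](card_ord n) -card_draws.
rewrite -[X in X <= _](card_ord m); apply: leq_trans (leq_imset_card c _).
by apply/subset_leq_card/subsetP=> k _; apply: allc.
Qed.

Lemma g_max n G Fam m : admissible n G Fam m -> m <= g n G Fam.
Proof.
move=> adm; have lt_m : m < 'C(n, 2).+1 by rewrite ltnS (admissible_bound adm).
exact: (@leq_bigmax_cond _ _ (fun i : 'I_('C(n, 2).+1) => i : nat)
          (Ordinal lt_m) adm).
Qed.

Lemma g_attained n G Fam :
  (exists m, admissible n G Fam m) -> admissible n G Fam (g n G Fam).
Proof.
case=> m adm; have lt_m : m < 'C(n, 2).+1 by rewrite ltnS (admissible_bound adm).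
have [|i admi gE] := @eq_bigmax_cond _
  (fun i : 'I_('C(n, 2).+1) => admissible n G Fam i) (fun i => i : nat).
  by apply/card_gt0P; exists (Ordinal lt_m).
by rewrite /g gE.
Qed.

Lemma K2_notin_supergraphs_K3 : ~~ supergraphs (complete 3) (complete 2).
Proof.
apply/existsP=> -[f /andP[/injectiveP/leq_card]].
by rewrite /= !card_ord.
Qed.

(* Main.v *)
Require Import Defs.
From mathcomp Require Import all_boot.

(** A color class containing [K_3] is the same as a monochromatic triangle, so
    each value of [g] is a maximum number of colors under a local condition on
    the triangles of four vertices.

    For [K_4], [n] colors are reached by giving color 0 to all edges that avoid
    a fixed vertex and distinct nonzero colors to the edges at that vertex:
    three of any four vertices avoid it ([star_coloring_admissible]).
    Conversely, at most [|S|] colors occur inside a vertex set [S], by induction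
    on [|S|] ([K4_colors_le]).  It is enough to find a vertex of [S] whose
    deletion loses at most one color, and such a vertex exists
    ([exists_vertex_losing_at_most_one]).  Indeed, let the deletion of [v] lose
    two colors, those of [va] and [vb].  These two color classes are stars
    centered at [v], so no monochromatic triangle contains [va] or [vb].  Hence
    for every other [x] the monochromatic triangle among [v,a,b,x] is [abx].
    Every color at [a], except possibly that of [va], is thus seen on an edge at
    [b] that avoids [a], and the deletion of [a] loses at most one color.

    For [K_4 - e], if [ab] and [ac] had different colors, then [abc] would not be
    monochromatic, so for any fourth vertex [d] both [abd] and [acd] would be:
    the two triangles of a [K_4 - e] share an edge, and one of them is
    monochromatic.  Then [ad] would have the color of [ab] and that of [ac].  So
    adjacent edges have equal colors, and hence all edges do
    ([K4e_single_color]). *)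

Set Implicit Arguments.
Unset Strict Implicit.
Unset Printing Implicit Defensive.

(** * Colorings of pairs *)

Section PairColorings.
Variables (T K : finType) (c : {set T} -> K).
Implicit Types (S e : {set T}) (a b v x y z : T).

Definition mono x y z :=
  (c [set x; y] == c [set x; z]) && (c [set x; y] == c [set y; z]).

Lemma mono_swap12 x y z : mono x y z = mono y x z.
Proof.
rewrite /mono (setUC [set y] [set x]).
by apply/andP/andP=> -[/eqP-> /eqP->].
Qed.

Lemma mono_swap23 x y z : mono x y z = mono x z y.
Proof.
rewrite /mono (setUC [set z] [set y]).
by apply/andP/andP=> -[/eqP-> /eqP->].
Qed.

Definition pairs_in S : {set {set T}} := [set e : {set T} | e \subset S & #|e| == 2].

Definition colors_in S := c @: pairs_in S.

Lemma pairs_inP S e :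
  reflect (exists x y, [/\ x \in S, y \in S, x != y & e = [set x; y]])
          (e \in pairs_in S).
Proof.
apply: (iffP idP) => [|[x [y [xS yS ne_xy ->]]]]; rewrite inE.
  case/andP=> sub /cards2P[x [y [ne_xy eE]]].
  exists x, y; split=> //; apply: (subsetP sub); rewrite eE !inE eqxx ?orbT //.
by rewrite cards2 ne_xy andbT subUset !sub1set xS yS.
Qed.

Definition lost_colors S v := colors_in S :\: colors_in (S :\ v).

Lemma lost_color_star S v x y :
  x \in S -> y \in S -> x != y -> c [set x; y] \in lost_colors S v ->
  (x == v) || (y == v).
Proof.
move=> xS yS ne_xy; rewrite inE => /andP[lost _]; apply: contraR lost.
rewrite negb_or => /andP[xv yv]; apply/imset_f/pairs_inP.
by exists x, y; split=> //; rewrite !inE ?xv ?yv.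
Qed.

Lemma lost_colorP S v k : k \in lost_colors S v ->
  exists a, [/\ a \in S, v != a & k = c [set v; a]].
Proof.
move=> lost; have: k \in colors_in S by move: lost; rewrite inE => /andP[].
case/imsetP=> e /pairs_inP[x [y [xS yS ne_xy ->]]] kE.
move: lost; rewrite kE => /(lost_color_star xS yS ne_xy).
case/orP=> /eqP vE; [exists y | exists x]; split=> //.
- by rewrite -vE.
- by rewrite vE.
- by rewrite -vE eq_sym.
- by rewrite vE setUC.
Qed.

Definition K4_condition := forall v a b x, uniq [:: v; a; b; x] ->
  [|| mono v a b, mono v a x, mono v b x | mono a b x].

(** A color class that deletion of [v] loses is a star at [v], hence contains no
    triangle: this excludes all triangles but [abx]. *)
Lemma mono_off_lost_edges S v a b x :
  K4_condition -> {subset [:: v; a; b; x] <= S} -> uniq [:: v; a; b; x] ->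
  c [set v; a] \in lost_colors S v -> c [set v; b] \in lost_colors S v ->
  mono a b x.
Proof.
move=> K4 sub un la lb; have /= := un.
rewrite !inE !negb_or -!andbA => /and4P[va vb vx /and4P[ab ax bx _]].
have inS y : y \in [:: v; a; b; x] -> y \in S by apply: sub.
have off k y z : k \in lost_colors S v -> y \in [:: v; a; b; x] ->
    z \in [:: v; a; b; x] -> y != z -> v != y -> v != z -> k != c [set y; z].
  move=> lk /inS yS /inS zS yz vy vz; apply: contraL lk => /eqP->.
  by apply/negP=> /(lost_color_star yS zS yz); rewrite !(eq_sym _ v) (negPf vy) (negPf vz).
case/or4P: (K4 _ _ _ _ un) => // /andP[_ /eqP E].
- by have := off _ a b la; rewrite !inE !eqxx ?orbT E eqxx ab va vb => /(_ isT isT isT isT isT).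
- by have := off _ a x la; rewrite !inE !eqxx ?orbT E eqxx ax va vx => /(_ isT isT isT isT isT).
by have := off _ b x lb; rewrite !inE !eqxx ?orbT E eqxx bx vb vx => /(_ isT isT isT isT isT).
Qed.

(** If [v] loses two colors, those of [va] and [vb], then each edge [ay] with
    [y] other than [v] has the color of an edge at [b] that avoids [a]. So the
    only color that [a] can lose is that of [va]. *)
Lemma exists_vertex_losing_at_most_one S : K4_condition -> 3 < #|S| ->
  exists2 v, v \in S & #|lost_colors S v| <= 1.
Proof.
move=> K4 S_gt3; have /card_gt0P[v vS] : 0 < #|S| by apply: leq_trans S_gt3.
have [small | /card_gt1P[k [k' [lk lk' ne_k]]]] := leqP #|lost_colors S v| 1.
  by exists v.
have [a [aS va kE]] := lost_colorP lk; have [b [bS vb k'E]] := lost_colorP lk'.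
move: lk lk' ne_k; rewrite {}kE {}k'E => la lb ne_k.
have ab : a != b by apply: contraNneq ne_k => ->.
have tri x : x \in S -> x != v -> x != a -> x != b -> mono a b x.
  move=> xS xv xa xb; apply: (mono_off_lost_edges K4 _ _ la lb).
    by move=> y; rewrite !inE => /or4P[]/eqP->.
  by rewrite /= !inE !negb_or !(eq_sym _ x) va vb ab xv xa xb.
exists a => //; rewrite -(cards1 (c [set v; a])).
apply/subset_leq_card/subsetP=> l la'.
have [y [yS ay lE]] := lost_colorP la'; rewrite inE lE.
have [-> | yv] := eqVneq y v; first by rewrite setUC.
(* Any color shared with an edge [bx], where [x] is not [a], is not lost by [a]. *)
have absurd x : x \in S -> x != a -> x != b -> c [set a; y] != c [set b; x].
  move=> xS xa xb; apply/eqP=> E; move: la'; rewrite lE E.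
  move/(lost_color_star bS xS); rewrite eq_sym xb => /(_ isT).
  by rewrite eq_sym (negPf ab) (negPf xa).
(* An edge [ay] has the color of [by]; the edge [ab] has that of [bx] for any
   fourth vertex [x]. *)
have [yb | yb] := eqVneq y b; last first.
  have := tri y yS yv; rewrite eq_sym => /(_ ay yb) /andP[/eqP E1 /eqP E2].
  by have := absurd y yS; rewrite eq_sym ay yb -E1 E2 eqxx => /(_ isT isT).
have /subsetPn[x xS] : ~~ (S \subset [set v; a; b]).
  apply/negP=> /subset_leq_card; rewrite leqNgt => /negP[].
  apply: leq_trans S_gt3; rewrite ltnS -setUA cardsU1 cards2 ab.
  by case: (_ \notin _).
rewrite !inE !negb_or -andbA => /and3P[xv xa xb].
have /andP[_ /eqP E] := tri x xS xv xa xb.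
by have := absurd x xS xa xb; rewrite yb E eqxx.
Qed.

Lemma K4_colors_le S : K4_condition -> #|colors_in S| <= #|S|.
Proof.
move=> K4; have [n] := ubnP #|S|; elim: n S => // n IHn S; rewrite ltnS => leSn.
have [small | S_gt3] := leqP #|S| 3.
  (* A set of at most three points has at most as many pairs as points. *)
  apply: leq_trans (leq_imset_card _ _) _; rewrite cards_draws.
  by case: #|S| small => [|[|[|[]]]].
have [v vS lost] := exists_vertex_losing_at_most_one K4 S_gt3.
have cardS := cardsD1 v S; rewrite vS in cardS.
rewrite -(cardsID (colors_in (S :\ v)) (colors_in S)) cardS addnC.
apply: leq_add lost _; apply: leq_trans (subset_leq_card (subsetIr _ _)) _.
by apply: IHn; apply: leq_trans leSn; rewrite cardS.
Qed.

Definition K4e_condition := forall u a b w, uniq [:: u; a; b; w] ->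
  mono u a b || mono a b w.

Lemma K4e_single_color : K4e_condition -> 3 < #|T| -> #|colors_in setT| <= 1.
Proof.
move=> K4e T_gt3.
have adjacent x y z : x != y -> x != z -> c [set x; y] = c [set x; z].
  move=> xy xz; have [-> // | yz] := eqVneq y z.
  have [w] : exists w, w \notin [set x; y; z].
    apply/existsP; rewrite -negb_forall; apply/negP=> /forallP all3.
    have : #|T| <= #|[set x; y; z]|.
      by apply/subset_leq_card/subsetP=> t _; apply: all3.
    rewrite leqNgt => /negP[]; apply: leq_trans T_gt3; rewrite ltnS -setUA.
    by rewrite cardsU1 cards2 yz; case: (_ \notin _).
  rewrite !inE !negb_or -andbA => /and3P[wx wy wz].
  case not_mono: (mono x y z); first by case/andP: not_mono => /eqP.
  have /orP[] : mono z x y || mono x y w.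
  - by apply: K4e; rewrite /= !inE !negb_or !(eq_sym _ w) wx wy wz xy (eq_sym z) xz eq_sym yz.
  - by rewrite mono_swap12 mono_swap23 not_mono.
  case/andP=> /eqP-> _.
  have /orP[] : mono y x z || mono x z w.
  - by apply: K4e; rewrite /= !inE !negb_or !(eq_sym _ w) wx wy wz xz (eq_sym y x) xy yz.
  - by rewrite mono_swap12 not_mono.
  by case/andP=> /eqP->.
have [-> // | /card_gt0P[k0 k0P]] := posnP #|colors_in setT|.
rewrite -(cards1 k0); apply/subset_leq_card/subsetP=> k kP; rewrite inE.
case/imsetP: k0P => _ /pairs_inP[x [y [_ _ xy ->]]] ->.
case/imsetP: kP => _ /pairs_inP[z [t [_ _ zt ->]]] ->.
have [xz | xz] := eqVneq x z; first by rewrite xz (adjacent z t y) // -xz.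
by rewrite (adjacent x y z xy xz) (setUC [set x]); apply/eqP/adjacent; rewrite // eq_sym.
Qed.

End PairColorings.

(** * From families of graphs to monochromatic triangles *)

(** The injectivity of the map from [K_3] comes for free in a simple graph, so
    containing [K_3] only means having three pairwise adjacent vertices. *)
Lemma contains_K3P (G : sgraph) :
  reflect (exists p q r : G, [/\ adj p q, adj p r & adj q r])
          (contains (complete 3) G).
Proof.
apply: (iffP existsP) => [[f /andP[_ /forallP adjf]] | [p [q [r [pq pr qr]]]]].
  pose o i : 'I_3 := inord i.
  have adj_o i j : i < 3 -> j < 3 -> i != j -> adj (f (o i)) (f (o j)).
    move=> i3 j3 ij; have /forallP/(_ (o j))/implyP := adjf (o i); apply.
    by rewrite /= -val_eqE /= !inordK.
  by exists (f (o 0)), (f (o 1)), (f (o 2)); split; apply: adj_o.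
pose f := [ffun i : 'I_3 => nth p [:: p; q; r] i].
have adjf (i j : 'I_3) : i != j -> adj (f i) (f j).
  rewrite !ffunE -val_eqE.
  by case: i => [[|[|[|//]]] ?]; case: j => [[|[|[|//]]] ?] //= _; rewrite adj_sym.
exists f; apply/andP; split; last first.
  by apply/forallP=> i; apply/forallP=> j; apply/implyP=> /adjf.
apply/injectiveP=> i j eq_f; apply/eqP; apply: contraTT isT => /adjf.
by rewrite eq_f adj_irr.
Qed.

Section ColorClasses.
Variables (n m : nat) (c : coloring n m) (G : sgraph) (f : {ffun G -> 'I_n}).
Hypothesis inj_f : injective f.

Lemma edge_of_copyP (p q : G) :
  ([set f p; f q] \in copy_edges f) = adj p q.
Proof.
apply/imsetP/idP=> [[[p' q']] | pq]; last by exists (p, q); rewrite ?inE.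
rewrite inE /= => pq' E.
have neq : p' != q' by apply: contraTneq pq' => ->; rewrite adj_irr.
have: f p' \in [set f p; f q] by rewrite E !inE eqxx.
have: f q' \in [set f p; f q] by rewrite E !inE eqxx orbT.
rewrite !inE !(inj_eq inj_f) => /orP[]/eqP qE /orP[]/eqP pE;
  move: neq pq'; rewrite pE qE ?eqxx // => _.
by rewrite adj_sym.
Qed.

Lemma color_class_K3P :
  reflect (exists p q r : G, [/\ adj p q, adj p r, adj q r & mono c (f p) (f q) (f r)])
   [exists k, (k \in c @: copy_edges f)
      && supergraphs (complete 3) (color_class c (copy_edges f) k)].
Proof.
apply: (iffP existsP) => [[k /andP[_ /contains_K3P]] | [p [q [r [pq pr qr]]]]].
  case=> x [y [z [/andP[xy cxy] /andP[xz cxz] /andP[yz cyz]]]].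
  have onto (u w : {x | x \in cover [set e in copy_edges f | c e == k]}) :
      [set val u; val w] \in [set e in copy_edges f | c e == k] ->
      exists2 p, val u = f p & exists q, val w = f q.
    rewrite inE => /andP[/imsetP[[p q] _ /= E] _].
    have: val u \in [set f p; f q] by rewrite -E !inE eqxx.
    have: val w \in [set f p; f q] by rewrite -E !inE eqxx orbT.
    rewrite !inE => wE uE.
    have [q' wq] : exists q', val w = f q'.
      by case/orP: wE => /eqP->; [exists p | exists q].
    by case/orP: uE => /eqP->; [exists p | exists q] => //; exists q'.
  have [p xE [q yE]] := onto _ _ cxy; have [_ _ [r zE]] := onto _ _ cxz.
  exists p, q, r; move: cxy cxz cyz; rewrite xE yE zE !inE !edge_of_copyP.
  move=> /andP[-> /eqP cpq] /andP[-> /eqP cpr] /andP[-> /eqP cqr].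
  by split=> //; rewrite /mono cpq cpr cqr eqxx.
move=> /andP[/eqP epr /eqP eqr]; set k := c [set f p; f q] in epr eqr.
exists k; apply/andP; split.
  by apply/imset_f; rewrite edge_of_copyP.
pose A := [set e in copy_edges f | c e == k].
have Apq : [set f p; f q] \in A by rewrite inE edge_of_copyP pq eqxx.
have Apr : [set f p; f r] \in A by rewrite inE edge_of_copyP pr -epr eqxx.
have Aqr : [set f q; f r] \in A by rewrite inE edge_of_copyP qr -eqr eqxx.
have Vp : f p \in cover A by apply/bigcupP; exists [set f p; f q]; rewrite // !inE eqxx.
have Vq : f q \in cover A by apply/bigcupP; exists [set f q; f r]; rewrite // !inE eqxx.
have Vr : f r \in cover A.
  by apply/bigcupP; exists [set f q; f r]; rewrite // !inE eqxx orbT.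
have neq s t : adj s t -> f s != f t.
  by rewrite (inj_eq inj_f); apply: contraTneq => ->; rewrite adj_irr.
apply/contains_K3P.
exists (exist _ (f p) Vp), (exist _ (f q) Vq), (exist _ (f r) Vr).
by split; apply/andP; split=> //; rewrite -val_eqE /= neq.
Qed.

End ColorClasses.

Arguments color_class_K3P {n m} c G {f} inj_f.

(** * The local conditions on four vertices *)

Section FourVertices.
Variables (n m : nat) (c : coloring n m).

Lemma copy_on_four_vertices (u a b w : 'I_n) : uniq [:: u; a; b; w] ->
  exists2 f : {ffun 'I_4 -> 'I_n}, injective f &
    forall i : 'I_4, f i = nth u [:: u; a; b; w] i.
Proof.
move=> un; exists [ffun i : 'I_4 => nth u [:: u; a; b; w] i] => [i j|i].
  by rewrite !ffunE => /eqP; rewrite nth_uniq // => /eqP/val_inj.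
by rewrite ffunE.
Qed.

Lemma mono_perms (x y z : 'I_n) : mono c x y z ->
  [/\ mono c x z y, mono c y x z, mono c y z x, mono c z x y & mono c z y x].
Proof.
move=> mo; have m1 : mono c x z y by rewrite mono_swap23.
have m2 : mono c y x z by rewrite mono_swap12.
have m3 : mono c y z x by rewrite mono_swap23.
have m4 : mono c z x y by rewrite mono_swap12.
by split=> //; rewrite mono_swap12.
Qed.

Lemma K4_condition_of_class :
  every_copy_has_class c (complete 4) (supergraphs (complete 3)) ->
  K4_condition c.
Proof.
move=> /forallP has_class u a b w /copy_on_four_vertices[f inj_f fE].
have /implyP := has_class f; move/(_ (introT (injectiveP f) inj_f)).
case/(color_class_K3P c (complete 4) inj_f) => p [q [r [/= pq pr qr]]].
rewrite !fE => mo; have [m1 m2 m3 m4 m5] := mono_perms mo.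
move: pq pr qr mo m1 m2 m3 m4 m5; rewrite -!val_eqE.
by case: p => [[|[|[|[|//]]]] /= _]; case: q => [[|[|[|[|//]]]] /= _] //;
   case: r => [[|[|[|[|//]]]] /= _] // _ _ _ mo m1 m2 m3 m4 m5;
   rewrite ?mo ?m1 ?m2 ?m3 ?m4 ?m5 ?orbT.
Qed.

Lemma adj_K4_minus_e (p q : 'I_4) : @adj K4_minus_e p q ->
  (p != q) && ((val p, val q) \notin [:: (0, 3); (3, 0)]).
Proof.
case/andP=> /= -> miss; rewrite !inE negb_or /=; apply/andP; split;
  apply: contra miss => /eqP[pE qE].
- by have [-> ->] : p = ord0 /\ q = ord_max by split; apply: val_inj.
- have [-> ->] : p = ord_max /\ q = ord0 by split; apply: val_inj.
  by rewrite setUC.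
Qed.

Lemma K4e_condition_of_class :
  every_copy_has_class c K4_minus_e (supergraphs (complete 3)) ->
  K4e_condition c.
Proof.
move=> /forallP has_class u a b w /copy_on_four_vertices[f inj_f fE].
have /implyP := has_class f; move/(_ (introT (injectiveP f) inj_f)).
case/(color_class_K3P c K4_minus_e inj_f) => p [q [r []]].
move=> /adj_K4_minus_e pq /adj_K4_minus_e pr /adj_K4_minus_e qr.
rewrite !fE => mo; have [m1 m2 m3 m4 m5] := mono_perms mo.
move: pq pr qr mo m1 m2 m3 m4 m5; rewrite -!val_eqE.
by case: p => [[|[|[|[|//]]]] /= _]; case: q => [[|[|[|[|//]]]] /= _] //;
   case: r => [[|[|[|[|//]]]] /= _] // _ _ _ mo m1 m2 m3 m4 m5;
   rewrite ?mo ?m1 ?m2 ?m3 ?m4 ?m5 ?orbT.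
Qed.

Lemma colors_in_full : uses_all_colors c -> #|colors_in c setT| = m.
Proof.
move=> /forallP all_used; rewrite -[RHS](card_ord m) -cardsT.
have pairsE : pairs_in setT = edges n by apply/setP=> e; rewrite !inE subsetT.
by congr #|pred_of_set _|; apply/setP=> k; rewrite /colors_in pairsE all_used inE.
Qed.

End FourVertices.

(** * Extremal colorings *)

(** The largest element of an edge at [ord0] is its other endpoint, so these
    edges get all the nonzero colors, once each. *)
Definition star_coloring n : coloring n.+1 n.+1 :=
  [ffun e : {set 'I_n.+1} =>
     inord (if ord0 \in e then \max_(i in e) i else 0)].

Lemma star_coloring_off0 n (x y : 'I_n.+1) :
  x != ord0 -> y != ord0 -> star_coloring n [set x; y] = ord0.
Proof.
move=> x0 y0; rewrite ffunE !inE !(eq_sym ord0) (negPf x0) (negPf y0).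
by apply: val_inj; rewrite /= inordK.
Qed.

Lemma star_coloring_at0 n (k : 'I_n.+1) :
  k != ord0 -> star_coloring n [set ord0; k] = k.
Proof.
move=> k0; rewrite ffunE !inE eqxx /= big_setU1 ?inE 1?eq_sym //= big_set1.
by rewrite max0n inord_val.
Qed.

Lemma star_coloring_admissible n : 4 <= n ->
  admissible n (complete 4) (supergraphs (complete 3)) n.
Proof.
case: n => // n n_ge4; apply/existsP; exists (star_coloring n); apply/andP; split.
  apply/forallP=> k; have [-> | k0] := eqVneq k ord0; last first.
    by rewrite -(star_coloring_at0 k0); apply: imset_f; rewrite inE cards2 (eq_sym ord0) k0.
  have i0 i : 0 < i < 3 -> (inord i : 'I_n.+1) != ord0.
    case/andP=> i_gt0 i_lt3; rewrite -val_eqE /= inordK -?lt0n //.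
    by apply: leq_trans n_ge4; apply: ltnW.
  rewrite -(star_coloring_off0 (i0 1 isT) (i0 2 isT)); apply: imset_f.
  by rewrite inE cards2 -val_eqE /= !inordK //; apply: leq_trans n_ge4.
apply/forallP=> f; apply/implyP=> /injectiveP inj_f.
apply/(color_class_K3P _ (complete 4) inj_f).
(* At most one vertex [j] of the copy is sent to [ord0]; omit it. *)
have [j jP] : exists j : 'I_4, forall i, f i = ord0 -> i = j.
  have [/existsP[j /eqP fj] | /existsPn none] := boolP [exists j, f j == ord0].
    by exists j => i fi; apply: inj_f; rewrite fi.
  by exists ord0 => i fi; have := none i; rewrite fi eqxx.
have off i : f (lift j i) != ord0.
  by apply/eqP=> /jP/eqP; rewrite eq_sym (negPf (neq_lift _ _)).
exists (lift j (inord 0)), (lift j (inord 1)), (lift j (inord 2)).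
by rewrite /mono !star_coloring_off0 //= !(inj_eq lift_inj) -!val_eqE /= !inordK.
Qed.

Lemma constant_coloring_admissible n : 2 <= n ->
  admissible n K4_minus_e (supergraphs (complete 3)) 1.
Proof.
move=> n_ge2; apply/existsP; exists [ffun=> ord0]; apply/andP; split.
  apply/forallP=> k; rewrite (ord1 k); apply/imsetP.
  have /card_gt1P[x [y [_ _ xy]]] : 1 < #|'I_n| by rewrite card_ord.
  by exists [set x; y]; rewrite ?inE ?cards2 ?xy ?ffunE.
apply/forallP=> f; apply/implyP=> /injectiveP inj_f.
apply/(color_class_K3P _ K4_minus_e inj_f).
have adjE (p q : 'I_4) : p != q -> q != ord_max -> p != ord_max ->
    @adj K4_minus_e p q.
  move=> pq q3 p3; apply/andP; split=> //; apply/eqP=> /setP/(_ ord_max).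
  by rewrite !inE eqxx orbT !(eq_sym ord_max) (negPf p3) (negPf q3).
exists (inord 0), (inord 1), (inord 2).
split; try by apply: adjE; rewrite -val_eqE /= ?inordK.
by rewrite /mono !ffunE !eqxx.
Qed.

Theorem theorem9p5 : forall n : nat, 4 <= n ->
  g n (complete 4) (supergraphs (complete 3)) = n /\
  g n K4_minus_e (supergraphs (complete 3)) = 1.
Proof.
move=> n n_ge4; split; apply/eqP; rewrite eqn_leq; apply/andP; split.
- apply/bigmax_leqP=> m /existsP[c /andP[all_used has_class]].
  rewrite -(colors_in_full all_used) -[X in _ <= X](card_ord n) -cardsT.
  exact: K4_colors_le (K4_condition_of_class has_class).
- exact: g_max (star_coloring_admissible n_ge4).
- apply/bigmax_leqP=> m /existsP[c /andP[all_used has_class]].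
  rewrite -(colors_in_full all_used).
  by apply: K4e_single_color (K4e_condition_of_class has_class) _; rewrite card_ord.
- by apply/g_max/constant_coloring_admissible/ltnW/ltnW.
Qed.
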